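(* Let $h_1:A_1\to A_1$ and $h_2:A_2\to A_2$ be two functions, and let $(B_j,i_j,v_j,p_j)$ be the standard dilation of $h_j$ for $j=1,2$. Suppose $s:A_2\to A_1$ is a function such that $sh_2=h_1s$. Then there exists a function $r:B_2\to B_1$ such that $rv_2=v_1r$, $rp_2=p_1r$ and $ri_2=i_1s$. Conversely, if $r:B_2\to B_1$ is a function satisfying $rv_2=v_1r$ and $rp_2=p_1r$, then there exists a unique function $s:A_2\to A_1$ satisfying $ri_2=i_1s$ and $sh_2=h_1s$.
   Context: Let $\mathbb{Z}_+=\{0,1,2,\ldots\}$; for any self-map $f$, $f^0$ is the identity. The standard dilation of a function $h:A\to A$ is the quadruple $(B,i,v,p)$ with $B=A\times\mathbb{Z}_+$; $i:A\to B$, $i(a)=(a,0)$; $v:B\to B$, $v(a,m)=(a,m+1)$; $p:B\to B$, $p(a,m)=(h^m(a),0)$. Juxtaposition denotes composition of functions. *)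

(* Defs.v *)
From mathcomp Require Import all_boot.

Set Implicit Arguments.
Unset Strict Implicit.
Unset Printing Implicit Defensive.

(* The standard dilation (B, i, v, p) of h : A -> A.  Only p depends on h;
   i and v take the set A as an explicit argument. *)

Definition dilB (A : Type) : Type := (A * nat)%type.

Definition dili (A : Type) (a : A) : dilB A := (a, 0).

Definition dilv (A : Type) (b : dilB A) : dilB A := (b.1, b.2.+1).

Definition dilp (A : Type) (h : A -> A) (b : dilB A) : dilB A :=
  (iter b.2 h b.1, 0).

Arguments dili : clear implicits.
Arguments dilv : clear implicits.

(* Main.v *)
Require Import Defs.
From mathcomp Require Import all_boot.
From Stdlib Require Import FunctionalExtensionality.

(** A map s intertwining h2 and h1 lifts to r (a, m) = (s a, m): it commutes
    with the shifts because it leaves the level m alone, and with the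
    projections because s intertwines all iterates of h2 and h1.

    Conversely, the copy of A at level 0 of its dilation is exactly the set of
    fixed points of p, so a map r commuting with the projections sends level 0
    to level 0 ([dilp_intertwiner_level0]); its restriction to that level is
    the only candidate for s.  The function h is recovered from the dilation as
    the compression of v to level 0, that is h a = p (v (a, 0)), so r, which
    commutes with v and p, restricts to a map intertwining h2 and h1. *)

Lemma iter_intertwine (A1 A2 : Type) (h1 : A1 -> A1) (h2 : A2 -> A2)
    (s : A2 -> A1) (m : nat) (a : A2) :
  (forall x, s (h2 x) = h1 (s x)) -> s (iter m h2 a) = iter m h1 (s a).
Proof. by move=> sh; elim: m => //= m IHm; rewrite sh IHm. Qed.

(** The point (a, 0) is fixed by p, so its image under r is fixed by p too,
    and everything in the image of p lies at level 0. *)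
Lemma dilp_intertwiner_level0 (A1 A2 : Type) (h1 : A1 -> A1) (h2 : A2 -> A2)
    (r : dilB A2 -> dilB A1) (a : A2) :
  (forall b, r (dilp h2 b) = dilp h1 (r b)) ->
  r (dili A2 a) = dili A1 (r (dili A2 a)).1.
Proof.
move=> rp; have := rp (dili A2 a); rewrite {1}/dilp /= -/(dili A2 a).
by case: (r _) => x n; rewrite /dilp /= => -[_ ->].
Qed.

Theorem theorem1p15 (A1 A2 : Type) (h1 : A1 -> A1) (h2 : A2 -> A2) :
  (forall s : A2 -> A1,
     s \o h2 = h1 \o s ->
     exists r : dilB A2 -> dilB A1,
       [/\ r \o dilv A2 = dilv A1 \o r,
           r \o dilp h2 = dilp h1 \o r
         & r \o dili A2 = dili A1 \o s])
  /\
  (forall r : dilB A2 -> dilB A1,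
     r \o dilv A2 = dilv A1 \o r ->
     r \o dilp h2 = dilp h1 \o r ->
     exists! s : A2 -> A1,
       r \o dili A2 = dili A1 \o s /\ s \o h2 = h1 \o s).
Proof.
split=> [s /equal_f sh | r /equal_f rv /equal_f rp].
  exists (fun b => (s b.1, b.2)); split=> //.
  apply: functional_extensionality => -[a m].
  by rewrite /dilp /= (iter_intertwine _ _ h1 h2 s _ _ sh).
have r0 a := dilp_intertwiner_level0 _ _ _ _ _ a rp.
exists (fun a => (r (dili A2 a)).1); split; last first.
  move=> s [rs _]; apply: functional_extensionality => a.
  by have /= -> := equal_f rs a.
split; apply: functional_extensionality => a; first exact: r0.
(* (h2 a, 0) = p (v (a, 0)) holds by computation, and r commutes with p and v. *)
have rh2 : r (dili A2 (h2 a)) = dilp h1 (r (dilv A2 (dili A2 a))) :=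
  rp (dilv A2 (dili A2 a)).
have rv0 : r (dilv A2 (dili A2 a)) = dilv A1 (r (dili A2 a)) := rv _.
by rewrite /comp rh2 rv0 r0.
Qed.
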